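(* For every infinite cardinal $\kappa$ there are an anti-mitre Steiner triple system of cardinality $\kappa$ and an anti-mia Steiner triple system of cardinality $\kappa$. The examples are strongly minimal, i.e. these systems can be taken to be structures $(M,R)$ whose complete first-order theory is strongly minimal.
   Context: A Steiner triple system is viewed as a structure $(M,R)$ in the vocabulary $\{R\}$, $R$ ternary: $R$ holds only of distinct triples and in any order, and any two distinct points lie on a unique maximal $R$-clique (line), which has exactly 3 points. A finite partial Steiner triple system is a finite such structure in which any two distinct points lie in at most one block (3-element line). For a finite partial Steiner system $X$, a Steiner system $(M,R)$ is anti-$X$ if there is no embedding of $X$ into $M$ (as $\{R\}$-structures, i.e. no induced substructure of $M$ isomorphic to $X$). The mitre is the configuration with 7 points $x,a,b,c,a',b',c'$ and the 5 blocks $\{a,b,c\},\{a',b',c'\},\{x,a,c'\},\{x,b,b'\},\{x,c,a'\}$. The Pasch configuration has 6 points $D,E,F,G,H,X$ and the 4 blocks $\{D,E,G\},\{E,F,X\},\{D,F,H\},\{G,H,X\}$. The mia is the configuration with 7 points and 5 blocks obtained from the Pasch configuration by adding a new point $Z$ and a new block consisting of $Z$ and two points of the Pasch configuration not lying on a common block (e.g. $\{E,H,Z\}$). *)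

(* Defs.v *)
From mathcomp Require Import all_boot.
From mathcomp Require Import boolp classical_sets functions cardinality.

Set Implicit Arguments.
Unset Strict Implicit.
Unset Printing Implicit Defensive.

Local Open Scope classical_set_scope.
Local Open Scope card_scope.

Record structure : Type := Structure {
  carrier :> Type;
  rel3 : carrier -> carrier -> carrier -> Prop
}.

Definition clique (M : structure) (C : set M) : Prop :=
  forall x y z : M, C x -> C y -> C z ->
    x <> y -> x <> z -> y <> z -> rel3 x y z.

Definition maximal_clique (M : structure) (C : set M) : Prop :=
  clique C /\ forall D : set M, clique D -> C `<=` D -> D = C.

(* The six orderings of a triple are generated by the two transpositions in
   [sts_swap12] and [sts_swap23]. *)
Record steiner_triple_system (M : structure) : Prop := {
  sts_distinct : forall x y z : M,
    rel3 x y z -> [/\ x <> y, x <> z & y <> z];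
  sts_swap12 : forall x y z : M, rel3 x y z -> rel3 y x z;
  sts_swap23 : forall x y z : M, rel3 x y z -> rel3 x z y;
  sts_line : forall x y : M, x <> y ->
    exists C : set M,
      [/\ maximal_clique C, C x, C y,
          forall D : set M, maximal_clique D -> D x -> D y -> D = C
        & C #= `I_3]
}.

(* If every block has exactly three points, then [set x; y; z] can only be a
   block when x, y, z are distinct; the relation is symmetric by construction. *)
Definition block_structure (T : Type) (B : set (set T)) : structure :=
  @Structure T (fun x y z => B [set x; y; z]).

Definition embedding (X M : structure) (f : X -> M) : Prop :=
  injective f /\
  forall x y z : X, rel3 x y z <-> rel3 (f x) (f y) (f z).

Definition anti (X M : structure) : Prop :=
  ~ exists f : X -> M, embedding f.

Inductive mitre_point : Type :=
  mi_x | mi_a | mi_b | mi_c | mi_a' | mi_b' | mi_c'.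

Definition mitre : structure := block_structure
  [set [set mi_a; mi_b; mi_c];
       [set mi_a'; mi_b'; mi_c'];
       [set mi_x; mi_a; mi_c'];
       [set mi_x; mi_b; mi_b'];
       [set mi_x; mi_c; mi_a']].

Inductive pasch_point : Type := pD | pE | pF | pG | pH | pX.

Definition pasch_blocks : set (set pasch_point) :=
  [set [set pD; pE; pG];
       [set pE; pF; pX];
       [set pD; pF; pH];
       [set pG; pH; pX]].

(* [None] is the point Z added to the Pasch configuration. *)
Definition mia : structure := block_structure
  ([set Some @` b | b in pasch_blocks] `|`
   [set [set Some pE; Some pH; None]]).

(* [formula n] has its free variables among 0, ..., n-1.  The quantifier binds
   variable 0 of its body and shifts the others (de Bruijn indices). *)
Inductive formula : nat -> Type :=
  | Fbot n : formula n
  | Feq n (i j : 'I_n) : formula n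
  | Frel n (i j k : 'I_n) : formula n
  | Fimp n (p q : formula n) : formula n
  | Fall n (p : formula n.+1) : formula n.

Fixpoint sat (M : structure) (n : nat) (p : formula n) :
    n.-tuple M -> Prop :=
  match p in formula m return m.-tuple M -> Prop with
  | Fbot _ => fun=> False
  | Feq _ i j => fun e => tnth e i = tnth e j
  | Frel _ i j k => fun e => rel3 (tnth e i) (tnth e j) (tnth e k)
  | Fimp _ q r => fun e => sat q e -> sat r e
  | Fall _ q => fun e => forall x : M, sat q [tuple of x :: e]
  end.

Definition sentence : Type := formula 0.

Definition theory (M : structure) : set sentence :=
  [set s | sat s ([tuple] : 0.-tuple M)].

Definition model (T : set sentence) (N : structure) : Prop :=
  T `<=` theory N.

Definition definable_set (N : structure) (n : nat) (p : formula n.+1)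
    (a : n.-tuple N) : set N :=
  [set x | sat p [tuple of x :: a]].

Definition strongly_minimal (T : set sentence) : Prop :=
  forall N : structure, model T N ->
    infinite_set [set: N] /\
    forall (n : nat) (p : formula n.+1) (a : n.-tuple N),
      finite_set (definable_set p a) \/ finite_set (~` definable_set p a).

(* Main.v *)
(* The anti-mitre system is the projective space over F_2 and the anti-mia
   system the affine space over F_3, of dimension K: the points are the nonzero
   (resp. all) vectors, the lines the triples of distinct points with sum 0.
   Adding the three lines through the point x of a mitre and subtracting the
   two others gives 3x = 0, which forces x = 0 in characteristic 2.  In a Pasch
   configuration, three lines minus the fourth give 2(D + E + F) = 0; so in
   characteristic 3, D + E + F = 0 = D + E + G and F = G.

   Two tuples satisfying the same linear relations satisfy the same formulas, by
   back-and-forth.  Hence a definable set or its complement lies in the span of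
   the n parameters, which has at most q^n elements.  As this bound does not
   depend on the parameters, it is first-order and passes to all models of the
   theory. *)

Require Import Defs.
From mathcomp Require Import all_boot all_algebra ssrAC.
From mathcomp Require Import finmap monalg.
From mathcomp Require Import boolp classical_sets functions cardinality.

Set Implicit Arguments.
Unset Strict Implicit.
Unset Printing Implicit Defensive.

Import GRing.Theory.

Local Open Scope classical_set_scope.
Local Open Scope card_scope.

(** * Cardinal arithmetic *)

Lemma card_leT_inj T U (B : set U) : ([set: T] #<= B) ->
  exists2 f : T -> U, injective f & forall x, B (f x).
Proof.
move=> /card_leP[/= f]; exists (fun x => val (f (to_setT x))) => [x y|x].
  by move=> /val_inj /inj; rewrite !inE => /(_ I I)/(congr1 val).
exact: set_valP.
Qed.

(** A maximal partial bijection between [A] and [B], given by Zorn's lemma, exhausts one of the two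
    sets; otherwise one more pair could be added. *)
Lemma set_injection_total (T : Type) (A B : set T) :
  (exists f : T -> T, {in A &, injective f} /\ forall x, A x -> B (f x)) \/
  (exists f : T -> T, {in B &, injective f} /\ forall x, B x -> A (f x)).
Proof.
pose P (G : set (T * T)) := (forall x y, G (x, y) -> A x /\ B y) /\
  (forall x y x' y', G (x, y) -> G (x', y') -> x = x' <-> y = y').
have [|G [[GAB GI] Gmax]] := @Zorn_bigcup _ P.
  move=> F FP Ftot; split=> [x y [G /FP[+ _]]|]; first exact.
  move=> x y x' y' [G FG Gxy] [G' FG' Gxy'].
  by case: (Ftot _ _ FG FG') => GG';
    [have [_] := FP _ FG' | have [_] := FP _ FG]; apply=> //; apply: GG'.
have [AG|/existsNP[x /not_implyP[Ax /forallNP xG]]] :=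
    pselect (forall x, A x -> exists y, G (x, y)).
  left; have /choice[f fG] x : exists y, A x -> G (x, y).
    by have [/AG[y]|] := pselect (A x); [exists y|exists x].
  exists f; split=> [x y|x /fG/GAB[]//].
  by rewrite !inE => /fG Gx /fG Gy; apply: (iffRL (GI _ _ _ _ Gx Gy)).
have [BG|/existsNP[y /not_implyP[By /forallNP yG]]] :=
    pselect (forall y, B y -> exists x, G (x, y)).
  right; have /choice[f fG] y : exists x, B y -> G (x, y).
    by have [/BG[x']|] := pselect (B y); [exists x'|exists y].
  exists f; split=> [u v|u /fG/GAB[]//].
  by rewrite !inE => /fG Gx /fG Gy; apply: (iffLR (GI _ _ _ _ Gx Gy)).
case: (Gmax (G `|` [set (x, y)])).
  split=> [w|]; first by left.
  by move=> /(_ (x, y) (or_intror erefl)) /xG.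
split=> [u v [/GAB//|[-> ->]//]|u v u' v'].
case=> [Guv|[-> ->]] [Guv'|[-> ->]] //; first exact: GI.
  by split=> e; [move: Guv; rewrite e => /xG | move: Guv; rewrite e => /yG].
by split=> e; [move: Guv'; rewrite -e => /xG | move: Guv'; rewrite -e => /yG].
Qed.

Definition square_closed T (D : set T) (f : T -> T -> T) :=
  [/\ exists p q, [/\ D p, D q & p <> q],
      forall x y, D x -> D y -> D (f x y)
    & forall x y x' y', D x -> D y -> D x' -> D y' ->
        f x y = f x' y' -> x = x' /\ y = y'].

(* [D] is enlarged by a disjoint copy of itself: the three new quarters of the
   square are sent to the copy, each pair being first labelled by one of three
   elements [f (tag x) (tag y)] of [D]. *)
Lemma square_closed_extend T (D : set T) f (i : T -> T) :
  square_closed D f -> {in D &, injective i} ->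
  (forall x, D x -> (~` D) (i x)) ->
  exists D' f', [/\ square_closed D' f', D `<=` D', ~ D' `<=` D &
    forall x y, D x -> D y -> f' x y = f x y].
Proof.
move=> [[p [q [Dp Dq pq]]] fD fI] iI iD.
pose D' := D `|` i @` D.
(* [r x] is the element of [D] that [x] stands for, itself or its preimage under [i]; [tag] records
   which. *)
have /choice[r rP] x :
    exists y, D' x -> D y /\ (x = if x \in D then y else i y).
  have [Dx|nDx] := boolP (x \in D).
    by exists x => _; split; first exact: set_mem.
  have [[y Dy yx]|ny] := pselect ((i @` D) x); first by exists y.
  by exists x => -[/mem_set|//]; rewrite (negPf nDx).
pose tag x := if x \in D then p else q.
have Dtag x : D (tag x) by rewrite /tag; case: ifP.
have tagI x y : D' x -> D' y -> tag x = tag y -> r x = r y -> x = y.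
  move=> /rP[_ xE] /rP[_ yE] t e; rewrite xE yE e; move: t; rewrite /tag.
  by case: ifP; case: ifP => // _ _ /esym.
pose g x y := f (f (r x) (r y)) (f (tag x) (tag y)).
have Dg x y : D' x -> D' y -> D (g x y).
  by move=> /rP[? _] /rP[? _]; apply/fD; apply: fD.
have gI x y x' y' : D' x -> D' y -> D' x' -> D' y' -> g x y = g x' y' ->
    x = x' /\ y = y'.
  move=> Dx Dy Dx' Dy' e.
  have [[rx _] [ry _]] := (rP _ Dx, rP _ Dy).
  have [[rx' _] [ry' _]] := (rP _ Dx', rP _ Dy').
  have [] := fI _ _ _ _ (fD _ _ rx ry) (fD _ _ (Dtag x) (Dtag y))
    (fD _ _ rx' ry') (fD _ _ (Dtag x') (Dtag y')) e.
  by move=> /fI[]// erx ery /fI[]// etx ety; split; apply: tagI.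
exists D', (fun x y => if (x \in D) && (y \in D) then f x y else i (g x y)).
split; first split.
- by exists p, q; split=> //; left.
- move=> x y Dx Dy; case: ifP => [/andP[]|_].
    by rewrite !inE; left; apply: fD.
  by right; exists (g x y) => //; apply: Dg.
- move=> x y x' y' Dx Dy Dx' Dy'.
  case: ifP => [/andP[]|_]; case: ifP => [/andP[]|_]; rewrite ?inE.
  + by move=> ? ? ? ?; apply: fI.
  + move=> ux uy e; case: (iD _ (Dg _ _ Dx' Dy')); rewrite -e; exact: fD.
  + move=> ux uy e; case: (iD _ (Dg _ _ Dx Dy)); rewrite e; exact: fD.
  + by move=> /iI e; apply: gI => //; apply: e; rewrite inE; apply: Dg.
- by move=> x; left.
- by move=> /(_ (i p)) ip; apply: (iD p) => //; apply: ip; right; exists p.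
- by move=> x y Dx Dy; rewrite !mem_set.
Qed.

(** Zorn's lemma for extension of pairs [(D, f)]. The values of [f] outside [D] are arbitrary, so
    extension is only a preorder. *)
Lemma square_closed_maximal T (D0 : set T) f0 : square_closed D0 f0 ->
  exists D f, square_closed D f /\
    forall D' f', square_closed D' f' -> D `<=` D' ->
      (forall x y, D x -> D y -> f' x y = f x y :> T) -> D' `<=` D.
Proof.
move=> sq0; pose S := {Df : set T * (T -> T -> T) | square_closed Df.1 Df.2}.
pose dom (s : S) : set T := (sval s).1.
pose op (s : S) : T -> T -> T := (sval s).2.
pose R (s t : S) := `[< dom s `<=` dom t /\ forall x y, dom s x ->
  dom s y -> op t x y = op s x y >].
have [||C Ctot|[[D f] /= sq] Dmax] := @ZL_preorder S (exist _ (D0, f0) sq0) R.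
- by move=> s; apply/asboolP; split.
- move=> r s t /asboolP[rs rs'] /asboolP[st st']; apply/asboolP.
  split=> [x /rs/st //|x y rx ry].
  by rewrite st' ?rs'; auto.
- have [C0|/existsNP[s0 /contrapT Cs0]] := pselect (forall s, ~ C s).
    by exists (exist _ (D0, f0) sq0) => s /C0.
  pose D := [set x | exists2 s, C s & dom s x].
  have common x y : D x -> D y -> exists s, [/\ C s, dom s x & dom s y].
    move=> [s Cs sx] [t Ct ty].
    case: (Ctot _ _ Cs Ct) => /asboolP[st _]; [exists t|exists s];
      by split; auto.
  have /choice[f fP] (xy : T * T) : exists z, forall s, C s -> dom s xy.1 ->
      dom s xy.2 -> op s xy.1 xy.2 = z.
    case: xy => x y /=.
    have [[s [Cs sx sy]]|no] := pselect (exists s, [/\ C s, dom s x & dom s y]).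
      exists (op s x y) => t Ct tx ty.
      by case: (Ctot _ _ Cs Ct) => /asboolP[_ ->].
    by exists x => s Cs sx sy; case: no; exists s.
  have sq : square_closed D (fun x y => f (x, y)).
    split.
    + have [[p [q [Dp Dq pq]]] _ _] := proj2_sig s0.
      by exists p, q; split=> //; exists s0.
    + move=> x y Dx Dy; have [s [Cs sx sy]] := common _ _ Dx Dy.
      exists s; rewrite // -(fP (x, y) s) //.
      by have [_ + _] := proj2_sig s; apply.
    + move=> x y x' y' Dx Dy Dx' Dy'.
      have [s [Cs sx sy]] := common _ _ Dx Dy.
      have [t [Ct tx ty]] := common _ _ Dx' Dy'.
      have [u [Cu [ux uy] [ux' uy']]] : exists u, [/\ C u,
          dom u x /\ dom u y & dom u x' /\ dom u y'].
        case: (Ctot _ _ Cs Ct) => /asboolP[st _]; [exists t|exists s];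
          by split; auto.
      rewrite -(fP (x, y) u) // -(fP (x', y') u) //=.
      by have [_ _] := proj2_sig u; apply.
  exists (exist _ (D, fun x y => f (x, y)) sq) => s Cs.
  apply/asboolP; split=> /=.
    by move=> x sx; exists s.
  by move=> x y sx sy; apply/esym/(fP (x, y)).
exists D, f; split=> // D' f' sq' DD' ff'.
have : R (exist _ (D', f') sq') (exist _ (D, f) sq) by apply/Dmax/asboolP.
by case/asboolP.
Qed.

(** An infinite cardinal equals its square. For a maximal [D], [square_closed_extend] excludes an
    injection of [D] into its complement; so the complement, and then all of [T], injects into
    [D]. *)
Lemma infinite_square_inj (T : Type) : infinite_set [set: T] ->
  exists f : T -> T -> T, forall x y x' y', f x y = f x' y' -> x = x' /\ y = y'.
Proof.
move=> /infiniteP/card_leT_inj[h hI _].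
have /choice[g gP] x : exists n, range h x -> h n = x.
  by have [[n _ <-]|] := pselect (range h x); [exists n|exists 0].
have sq0 : square_closed (range h) (fun x y => h (choice.pickle (g x, g y))).
  split.
  - by exists (h 0), (h 1); split=> [||/hI//]; [exists 0|exists 1].
  - by move=> x y _ _; exists (choice.pickle (g x, g y)).
  - move=> x y x' y' /gP xE /gP yE /gP xE' /gP yE'.
    by move=> /hI/(pcan_inj choice.pickleK)[ex ey]; rewrite -xE -yE ex ey.
have [D [f [sq Dmax]]] := square_closed_maximal sq0.
have [[p [q [Dp Dq pq]]] fD fI] := sq.
have [[i [iI iD]]|[j [jI jD]]] := set_injection_total D (~` D).
  have [D' [f' [sq' DD' nD'D ff']]] := square_closed_extend sq iI iD.
  by case: nD'D; apply: Dmax ff'.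
(* The second arguments [p] and [q] keep the images of [D] and of its complement apart. *)
pose e x := if x \in D then f x p else f (j x) q.
have eD x : D (e x).
  rewrite /e; case: ifPn => [|/negP]; rewrite inE => xD; apply: fD => //.
  exact: jD.
have eI : injective e.
  move=> x y; rewrite /e.
  case: ifPn => [|/negP]; rewrite inE => xD;
  case: ifPn => [|/negP]; rewrite inE => yD.
  - by move=> /fI[].
  - by move=> /fI[//|//||//|_ /pq]; [apply: jD|].
  - by move=> /fI[||//|//|_ /esym/pq]//; apply: jD.
  - by move=> /fI[| | | |/jI +_]; rewrite ?inE; try exact: jD; auto.
exists (fun x y => f (e x) (e y)) => x y x' y' /fI[]// /eI -> /eI ->.
by [].
Qed.

(** The list is folded by the pairing; its length is stored too, because folds of lists of different
    lengths could coincide. *)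
Lemma infinite_seq_inj (T : Type) : infinite_set [set: T] ->
  exists f : seq T -> T, injective f.
Proof.
move=> Tinf; have [f fI] := infinite_square_inj Tinf.
have [h hI _] := card_leT_inj (iffLR (infiniteP _) Tinf).
exists (fun s => f (h (size s)) (foldr f (h 0%N) s)) => s t /fI[/hI].
by elim: s t => [|x s IHs] [|y t] //= [st] /fI[-> /(IHs _ st) ->].
Qed.

Lemma inj_card_leT (T U : Type) (f : T -> U) :
  injective f -> [set: T] #<= [set: U].
Proof.
move=> fI; rewrite -(card_le_eql (inj_card_eq (in2W fI))).
exact: subset_card_le.
Qed.

(** * Numerical bounds on definable sets *)

Definition lift_ren n m (f : 'I_n -> 'I_m) (i : 'I_n.+1) : 'I_m.+1 :=
  oapp (fun j => lift ord0 (f j)) ord0 (unlift ord0 i).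

Fixpoint rename n (p : formula n) : forall m, ('I_n -> 'I_m) -> formula m :=
  match p in formula n return forall m, ('I_n -> 'I_m) -> formula m with
  | Fbot _ => fun m _ => Fbot m
  | Feq _ i j => fun m f => Feq (f i) (f j)
  | Frel _ i j k => fun m f => Frel (f i) (f j) (f k)
  | Fimp _ q r => fun m f => Fimp (rename q f) (rename r f)
  | Fall _ q => fun m f => Fall (rename q (lift_ren f))
  end.

Lemma sat_rename (M : structure) n (p : formula n) m (f : 'I_n -> 'I_m)
    (e : m.-tuple M) :
  sat (rename p f) e <-> sat p [tuple tnth e (f i) | i < n].
Proof.
elim: p m f e => {n} [n|n i j|n i j k|n q IHq r IHr|n q IHq] m f e //=.
- by rewrite !tnth_mktuple.
- by rewrite !tnth_mktuple.
- by split=> H /IHq/H/IHr.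
have E x : [tuple tnth [tuple of x :: e] (lift_ren f i) | i < n.+1] =
           [tuple of x :: [tuple tnth e (f i) | i < n]].
  apply: eq_from_tnth => i; rewrite tnth_mktuple /lift_ren.
  by case: unliftP => [j|] ->; rewrite ?tnth0 //= !tnthS tnth_mktuple.
by split=> H x; move: (H x); rewrite IHq E.
Qed.

Fixpoint close n : formula n -> sentence :=
  match n return formula n -> sentence with
  | 0 => id
  | n.+1 => fun p => close (Fall p)
  end.

Lemma sat_close (M : structure) n (p : formula n) :
  theory M (close p) <-> forall e : n.-tuple M, sat p e.
Proof.
rewrite /theory /=; elim: n p => [|n IHn] p /=.
  by split=> [H e|]; rewrite ?[e]tuple0.
by rewrite IHn; split=> H e => [|x]; [case/tupleP: e => x e|]; apply: H.
Qed.

Fixpoint Fallk n k : formula (k + n) -> formula n :=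
  match k return formula (k + n) -> formula n with
  | 0 => id
  | k.+1 => fun p => Fallk (Fall p : formula (k + n))
  end.

Lemma sat_Fallk (M : structure) n k (p : formula (k + n)) (e : n.-tuple M) :
  sat (Fallk p) e <-> forall t : k.-tuple M, sat p [tuple of t ++ e].
Proof.
elim: k p => [|k IHk] p /=.
  have E (t : 0.-tuple M) : [tuple of t ++ e] = e.
    by apply: val_inj; rewrite /= [t]tuple0.
  by split=> [H t|/(_ [tuple])]; rewrite E.
rewrite IHk; split=> [H t|H t x].
  case/tupleP: t => x t; have := H t x; congr (sat _ _); exact: val_inj.
have := H [tuple of x :: t]; congr (sat _ _); exact: val_inj.
Qed.

Definition Fnot n (p : formula n) : formula n := Fimp p (Fbot n).

(** Stands in for a finite conjunction of hypotheses, as implication and falsity are the only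
    connectives. *)
Definition Fimps n (I : finType) (g : I -> formula n) (q : formula n) :=
  foldr (fun i => Fimp (g i)) q (enum I).

Lemma sat_Fimps (M : structure) n (I : finType) (g : I -> formula n) q
    (e : n.-tuple M) :
  sat (Fimps g q) e <-> ((forall i, sat (g i) e) -> sat q e).
Proof.
have -> : (forall i, sat (g i) e) = (forall i, i \in enum I -> sat (g i) e).
  by apply: propext; split=> H i => [_|]; [|apply: H; rewrite mem_enum].
rewrite /Fimps; elim: (enum I) => [|i s IHs] /=.
  by split=> // H; apply: H.
rewrite IHs; split=> [H Hs|H Hi Hs].
  apply: H => [|j js]; apply: Hs; first exact: mem_head.
  by rewrite inE js orbT.
by apply: H => j; rewrite inE => /orP[/eqP->|/Hs].
Qed.

(** The test on indices is decided outside the formula; over all pairs, these implications say that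
    the [k] variables are distinct. *)
Definition var_eq_imp n k (ij : 'I_k * 'I_k) : formula (k + n) :=
  Fimp (Feq (lshift n ij.1) (lshift n ij.2))
       (if ij.1 == ij.2 then Fnot (Fbot _) else Fbot _).

(** Fewer than [k] solutions. The renaming sends variable 0 of [p] to the [i]-th quantified variable
    and moves the parameters past all [k] of them. *)
Definition few n (p : formula n.+1) k : formula n :=
  Fallk (Fimps (@var_eq_imp n k)
    (Fimps (fun i : 'I_k => rename p
              (fun j => oapp (@rshift k n) (lshift n i) (unlift ord0 j)))
       (Fbot (k + n)))).

Lemma sat_few (M : structure) n (p : formula n.+1) k (a : n.-tuple M) :
  sat (few p k) a <->
  forall t : 'I_k -> M, injective t -> ~ forall i, definable_set p a (t i).
Proof.
have instE (t : k.-tuple M) (i : 'I_k) :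
    [tuple tnth [tuple of t ++ a]
       (oapp (@rshift k n) (lshift n i) (unlift ord0 j)) | j < n.+1] =
    [tuple of tnth t i :: a].
  apply: eq_from_tnth => j; rewrite tnth_mktuple.
  by case: unliftP => [j'|] ->; rewrite /= ?tnth_rshift ?tnth_lshift ?tnthS.
have distE (t : k.-tuple M) :
    (forall ij, sat (@var_eq_imp n k ij) [tuple of t ++ a]) <->
    injective (tnth t).
  split=> [H i j tij|H [i j]] /=.
    have := H (i, j); rewrite /= !tnth_lshift; case: eqP => // _.
    by move=> /(_ tij).
  by rewrite /= !tnth_lshift; case: eqP => //= ij /H /ij.
rewrite /few sat_Fallk; split=> H t.
  move=> tI Ht; have /sat_Fimps := H [tuple t i | i < k].
  have tE i : tnth [tuple t i | i < k] i = t i by rewrite tnth_mktuple.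
  rewrite distE => /(_ _)/sat_Fimps; apply=> [i j|i].
    by rewrite !tE => /tI.
  by rewrite sat_rename instE tE; apply: Ht.
apply/sat_Fimps => /distE/H tI; apply/sat_Fimps => Ht; apply: tI => i.
by have := Ht i; rewrite sat_rename instE.
Qed.

(** Pigeonhole: distinct solutions get distinct indices in [J]. The bound in [few] is strict, whence
    the successor. *)
Lemma few_image (M : structure) n (p : formula n.+1) (a : n.-tuple M)
    (T : Type) (f : M -> T) (J : finType) (g : J -> T) :
  injective f -> (forall x, definable_set p a x -> range g (f x)) ->
  sat (few p #|J|.+1) a.
Proof.
move=> fI pg; apply/sat_few => t tI Ht.
have /choice[h hE] i : exists j, g j = f (t i).
  by have [j _ <-] := pg _ (Ht i); exists j.
have hI : injective h by move=> i j hij; apply/tI/fI; rewrite -!hE hij.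
by have := leq_card h hI; rewrite card_ord ltnn.
Qed.

Lemma few_finite (M : structure) n (p : formula n.+1) k (a : n.-tuple M) :
  sat (few p k) a -> finite_set (definable_set p a).
Proof.
move=> /sat_few H; apply: contrapT => /infiniteP/card_leT_inj[f fI pf].
by apply: (H (fun i : 'I_k => f i)) => // i j /fI/val_inj.
Qed.

Lemma finite_few (M : structure) n (p : formula n.+1) (a : n.-tuple M) :
  finite_set (definable_set p a) -> exists k, sat (few p k) a.
Proof.
case=> k pk; exists k.+1; apply/sat_few => t tI Ht.
suff : (`I_k.+1 : set nat) #<= (`I_k : set nat) by rewrite card_le_II ltnn.
rewrite -(card_le_eqr pk) -(card_le_eql (inj_card_eq (f := t \o inord) _)).
  by apply: subset_card_le => _ [i _ <-]; apply: Ht.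
by move=> i j; rewrite !inE => ik jk /tI /(congr1 val); rewrite /= !inordK.
Qed.

(** Makes infinity of a structure expressible by sentences, which pass to the models of its
    theory. *)
Lemma finite_setT_few (M : structure) :
  finite_set [set: M] <->
  exists k, sat (few (Fnot (Fbot 1)) k) ([tuple] : 0.-tuple M).
Proof.
have E : definable_set (Fnot (Fbot 1)) ([tuple] : 0.-tuple M) = setT.
  by apply/seteqP; split=> // x _ [].
by rewrite -E; split=> [/finite_few|[k /few_finite]].
Qed.

Lemma definable_setC (M : structure) n (p : formula n.+1) (a : n.-tuple M) :
  ~` definable_set p a = definable_set (Fnot p) a.
Proof. by []. Qed.

(* The bound must be uniform in the parameters: "at most [k - 1] solutions" is
   then a first-order sentence, inherited by every model of the theory. *)
Lemma strongly_minimal_theory (M : structure) :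
  infinite_set [set: M] ->
  (forall n (p : formula n.+1), exists k, forall a : n.-tuple M,
     sat (few p k) a \/ sat (few (Fnot p) k) a) ->
  strongly_minimal (theory M).
Proof.
move=> Minf Mbd N MN; split.
  move=> /finite_setT_few[k Nk]; apply: Minf; apply/finite_setT_few; exists k.
  apply: contrapT => Mk.
  have /MN/sat_close/(_ [tuple]) :
      theory M (close (Fnot (few (Fnot (Fbot 1)) k))).
    by apply/sat_close => e; rewrite [e]tuple0.
  exact.
move=> n p a; have [k Mk] := Mbd n p.
have /MN/sat_close/(_ a) /= Na :
    theory M (close (Fimp (Fnot (few p k)) (few (Fnot p) k))).
  by apply/sat_close => e /=; case: (Mk e) => // ? [].
rewrite definable_setC; have [|/Na] := pselect (sat (few p k) a).
  by move=> /few_finite; left.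
by move=> /few_finite; right.
Qed.

Local Open Scope ring_scope.

(** * Zero-sum triples in a vector space *)

(** [P] will select the nonzero vectors in characteristic 2 and all vectors in characteristic 3. *)
Definition zero_sum_structure (V : zmodType) (P : pred V) : structure :=
  @Structure {v : V | P v} (fun x y z =>
    [/\ x <> y, x <> z, y <> z & val x + val y + val z = 0]).

(** The third point of the line through [u] and [v] must be [- (u + v)]; the hypothesis makes it a
    point distinct from both. *)
Lemma zero_sum_sts (V : zmodType) (P : pred V) :
  (forall u v : V, P u -> P v -> u <> v ->
     [/\ P (- (u + v)), - (u + v) <> u & - (u + v) <> v]) ->
  steiner_triple_system (zero_sum_structure P).
Proof.
move=> third; split=> [x y z []//|x y z [xy xz yz s]|x y z [xy xz yz s]|x y xy].
- by split=> // [/esym//|]; rewrite [val y + _]addrC.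
- by split=> // [/esym//|]; rewrite addrAC.
have [Pz zx zy] := third _ _ (valP x) (valP y) (fun e => xy (val_inj e)).
pose z : zero_sum_structure P := exist (fun v => is_true (P v)) _ Pz.
have xz : x <> z by move=> /(congr1 val)/esym.
have yz : y <> z by move=> /(congr1 val)/esym.
have zP w : rel3 x y w <-> w = z.
  split=> [[_ _ _ s]|->]; last by split=> //; rewrite /= subrr.
  by apply: val_inj; rewrite /= -[val w](addKr (val x + val y)) s addr0.
have R0 : rel3 x y z by apply/zP.
pose C := [set x; y; z].
(* A further point of a clique through [x] and [y] is related to them, hence is [z]; this yields
   both maximality and uniqueness of the line. *)
have zC D : clique D -> D x -> D y -> D `<=` C.
  move=> cD Dx Dy w Dw; rewrite /C /=.
  have [->|wx] := pselect (w = x); first by left; left.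
  have [->|wy] := pselect (w = y); first by left; right.
  right; apply/zP; apply: cD => // /esym //.
have cC : clique C.
  have sw12 u v w : @rel3 (zero_sum_structure P) u v w -> rel3 v u w.
    by case=> uv uw vw s; split=> // [/esym//|]; rewrite [val v + _]addrC.
  have sw23 u v w : @rel3 (zero_sum_structure P) u v w -> rel3 u w v.
    by case=> uv uw vw s; split=> // [/esym//|]; rewrite addrAC.
  by move=> a b c [[]|] -> [[]|] -> [[]|] -> ab ac bc; try congruence; auto 6.
exists C; split.
- split=> // D cD CD; apply/seteqP; split=> //.
  by apply: zC => //; apply: CD; rewrite /C /=; auto.
- by rewrite /C /=; auto.
- by rewrite /C /=; auto.
- by move=> D [cD mD] Dx Dy; rewrite (mD C)//; apply: zC.
(* The default [z] of [nth] is the value at index 2. *)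
pose f i : zero_sum_structure P := nth z [:: x; y] i.
have -> : C = f @` `I_3.
  apply/seteqP; split=> [w [[]|] ->|_ [[|[|[|//]]] _ <-]]; rewrite /C /=; auto.
  - by exists 0%N.
  - by exists 1%N.
  - by exists 2%N.
apply: inj_card_eq => i j; rewrite !inE /f.
case: i => [|[|[|//]]] _; case: j => [|[|[|//]]] _ //=; congruence.
Qed.

(** * Linear relations, back-and-forth and strong minimality *)

Section ZeroSumMinimal.
Variables (F : finFieldType) (V : lmodType F) (P : pred V).
Local Notation M := (zero_sum_structure P).

(** The coefficient vectors form a finite type, so the span of [n] points has at most [#|F| ^ n]
    elements. *)
Definition lincomb n (e : n.-tuple M) (c : {ffun 'I_n -> F}) : V :=
  \sum_i c i *: val (tnth e i).

Lemma lincomb_cons n x (e : n.-tuple M) (c : {ffun 'I_n.+1 -> F}) :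
  lincomb [tuple of x :: e] c =
  c ord0 *: val x + lincomb e [ffun i => c (lift ord0 i)].
Proof.
by rewrite /lincomb big_ord_recl tnth0; congr +%R; apply: eq_bigr => i _;
  rewrite ffunE tnthS.
Qed.

Lemma lincombD n (e : n.-tuple M) b (c d : {ffun 'I_n -> F}) :
  lincomb e [ffun i => b * c i + d i] = b *: lincomb e c + lincomb e d.
Proof.
rewrite /lincomb scaler_sumr -big_split; apply: eq_bigr => i _ /=.
by rewrite ffunE scalerDl scalerA.
Qed.

Lemma lincomb0 n (e : n.-tuple M) : lincomb e [ffun=> 0] = 0.
Proof. by rewrite /lincomb big1 // => i _; rewrite ffunE scale0r. Qed.

Lemma lincomb_delta n (e : n.-tuple M) i :
  lincomb e [ffun j => (j == i)%:R] = val (tnth e i).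
Proof.
rewrite /lincomb (bigD1 i) //= ffunE eqxx scale1r big1 ?addr0 // => j /negPf ji.
by rewrite ffunE ji scale0r.
Qed.

(** The back-and-forth invariant: sending [e] to [e'] entrywise extends to a linear isomorphism of
    the spans. *)
Definition same_relations n (e e' : n.-tuple M) : Prop :=
  forall c, lincomb e c = 0 <-> lincomb e' c = 0.

Lemma same_relations_sym n (e e' : n.-tuple M) :
  same_relations e e' -> same_relations e' e.
Proof. by move=> ee' c; rewrite ee'. Qed.

Hypothesis P_zero : forall u v : V, (u == 0) = (v == 0) -> P u = P v.
Hypothesis Minf : infinite_set [set: M].

Lemma exists_independent n (e : n.-tuple M) :
  exists x : M, ~ range (lincomb e) (val x).
Proof.
apply: contrapT => /forallNP H; apply: Minf; apply/finite_setT_few.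
exists #|{ffun 'I_n -> F}|.+1.
apply: (@few_image M _ _ _ _ val _ (lincomb e)) => [x y /val_inj //|x _].
exact: contrapT (H x).
Qed.

(** A vector outside the span has coefficient 0 in every relation, as a nonzero one could be
    inverted; only relations among the old points remain. *)
Lemma same_relations_independent n (e e' : n.-tuple M) (x y : M) :
  ~ range (lincomb e) (val x) -> ~ range (lincomb e') (val y) ->
  same_relations e e' ->
  same_relations [tuple of x :: e] [tuple of y :: e'].
Proof.
have key (z : M) (f : n.-tuple M) (c : {ffun 'I_n.+1 -> F}) :
    ~ range (lincomb f) (val z) ->
    lincomb [tuple of z :: f] c = 0 <->
    c ord0 = 0 /\ lincomb f [ffun i => c (lift ord0 i)] = 0.
  move=> zf; rewrite lincomb_cons; split=> [|[-> ->]]; last first.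
    by rewrite scale0r addr0.
  have [->|c0] := eqVneq (c ord0) 0; first by rewrite scale0r add0r.
  move=> /eqP; rewrite addr_eq0 => /eqP czE; case: zf.
  exists [ffun i => - (c ord0)^-1 * c (lift ord0 i) + 0] => //.
  rewrite (_ : [ffun i => _] = [ffun i => - (c ord0)^-1 *
     [ffun i => c (lift ord0 i)] i + [ffun=> 0] i]); last first.
    by apply/ffunP => i; rewrite !ffunE.
  rewrite lincombD lincomb0 addr0 scaleNr -scalerN -czE scalerA mulVf //.
  by rewrite scale1r.
by move=> xe ye ee' c; rewrite !key // ee'.
Qed.

(** A point of the span is copied with the same coefficients; a point outside it is matched by any
    point outside the other span. *)
Lemma same_relations_forth n (e e' : n.-tuple M) (x : M) :
  same_relations e e' ->
  exists y, same_relations [tuple of x :: e] [tuple of y :: e'].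
Proof.
move=> ee'.
have [[c _ cx]|xe] := pselect (range (lincomb e) (val x)); last first.
  have [y ye'] := exists_independent e'.
  by exists y; apply: same_relations_independent.
(* Equal relations make this combination zero exactly when [x] is, so [P_zero] applies. *)
have Py : P (lincomb e' c).
  rewrite -(@P_zero (val x)) ?(valP x) // -cx.
  by apply/eqP/eqP => /ee'.
exists (exist (fun v => is_true (P v)) _ Py) => d.
rewrite !lincomb_cons /= -cx -!lincombD; exact: ee'.
Qed.

(** Equality of two entries is itself a linear relation: their difference is 0. *)
Lemma same_relations_tnth n (e e' : n.-tuple M) i j : same_relations e e' ->
  tnth e i = tnth e j -> tnth e' i = tnth e' j.
Proof.
have key (f : n.-tuple M) : tnth f i = tnth f j <->
    lincomb f [ffun k => -1 * [ffun k => (k == j)%:R] k +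
               [ffun k => (k == i)%:R] k] = 0.
  rewrite lincombD !lincomb_delta scaleN1r addrC.
  by split=> [->|/eqP]; rewrite ?subrr // subr_eq0 => /eqP/val_inj.
by move=> ee' /key/ee'/key.
Qed.

Lemma same_relations_rel3 n (e e' : n.-tuple M) i j k : same_relations e e' ->
  rel3 (tnth e i) (tnth e j) (tnth e k) ->
  rel3 (tnth e' i) (tnth e' j) (tnth e' k).
Proof.
have key (f : n.-tuple M) : val (tnth f i) + val (tnth f j) + val (tnth f k) =
    lincomb f [ffun l => 1 * [ffun l => 1 * [ffun l => (l == i)%:R] l +
               [ffun l => (l == j)%:R] l] l + [ffun l => (l == k)%:R] l].
  by rewrite !lincombD !lincomb_delta !scale1r.
move=> ee' [ij ik jk]; rewrite key => /ee'; rewrite -key => s.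
have e'e := same_relations_sym ee'.
by split=> //; move=> /(same_relations_tnth e'e).
Qed.

Lemma sat_same_relations n (p : formula n) (e e' : n.-tuple M) :
  same_relations e e' -> sat p e <-> sat p e'.
Proof.
elim: p e e' => {n} [n|n i j|n i j k|n q IHq r IHr|n q IHq] e e' ee' //=;
  have e'e := same_relations_sym ee'.
- by split; apply: same_relations_tnth.
- by split; apply: same_relations_rel3.
- by rewrite (IHq _ _ ee') (IHr _ _ ee').
split=> H x.
  by have [y /IHq ->] := same_relations_forth x e'e.
by have [y /IHq ->] := same_relations_forth x ee'.
Qed.

(** All points outside the span of [a] satisfy the same formulas over [a], so [p] or its negation
    has all its solutions inside the span. *)
Lemma zero_sum_strongly_minimal : strongly_minimal (theory M).
Proof.
apply: strongly_minimal_theory => // n p.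
exists #|{ffun 'I_n -> F}|.+1 => a.
have [[x xa px]|H] := pselect (exists2 x : M, ~ range (lincomb a) (val x) &
    definable_set p a x); [right|left];
  apply: (@few_image M _ _ _ _ val _ (lincomb a)) => [x' y' /val_inj //|y py];
  apply: contrapT => ya; last by apply: H; exists y.
apply: py; apply: (iffLR (sat_same_relations p _)) px.
exact: same_relations_independent.
Qed.

End ZeroSumMinimal.

(** * Exclusion of the mitre and the mia *)

Lemma zero_sum_anti_mitre (V : zmodType) (P : pred V) :
  (forall v : V, v + v = 0) -> ~~ P 0 -> anti mitre (zero_sum_structure P).
Proof.
move=> char2 nP0 [f [_ fR]].
have [] : [/\ rel3 (mi_a : mitre) mi_b mi_c, rel3 (mi_a' : mitre) mi_b' mi_c',
    rel3 (mi_x : mitre) mi_a mi_c', rel3 (mi_x : mitre) mi_b mi_b' &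
    rel3 (mi_x : mitre) mi_c mi_a'].
  by split; rewrite /= /block_structure; auto 6.
move=> /fR[_ _ _ abc] /fR[_ _ _ abc'] /fR[_ _ _ l1] /fR[_ _ _ l2] /fR[_ _ _ l3].
(* Regrouped, the three lines through [x] sum to the other two blocks plus [3x]. *)
have := congr2 +%R (congr2 +%R l1 l2) l3.
rewrite [LHS](AC (3*3*3) ((2*5*8)*(9*6*3)*(1*4*7))) /= abc abc' !add0r.
rewrite -/(val _) char2 add0r => fx.
by move: nP0 (valP (f mi_x)); rewrite -[0]fx => /negPf ->.
Qed.

Lemma zero_sum_anti_mia (V : zmodType) (P : pred V) :
  (forall v : V, v + v + v = 0) -> anti mia (zero_sum_structure P).
Proof.
move=> char3 [f [fI fR]].
have blockR x y z : pasch_blocks [set x; y; z] ->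
    rel3 (Some x : mia) (Some y) (Some z).
  by move=> b; left; exists [set x; y; z]; rewrite // !image_setU !image_set1.
have [] : [/\ rel3 (Some pD : mia) (Some pE) (Some pG),
    rel3 (Some pE : mia) (Some pF) (Some pX),
    rel3 (Some pD : mia) (Some pF) (Some pH) &
    rel3 (Some pG : mia) (Some pH) (Some pX)].
  by split; apply: blockR; rewrite /pasch_blocks /=; auto.
move=> /fR[_ _ _ l1] /fR[_ _ _ l2] /fR[_ _ _ l3] /fR[_ _ _ l4].
(* Regrouped, the sum is [2 (D + E + F)] plus the block [G + H + X]. *)
have := congr2 +%R (congr2 +%R l1 l2) l3.
rewrite [LHS](AC (3*3*3) ((1*2*5)*(7*4*8)*(3*9*6))) /= l4 !addr0.
(* [3s = 0] and [2s = 0] give [s = 0] for [s = D + E + F]; comparison with [D + E + G = 0] yields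
   [F = G]. *)
move: (char3 (val (f (Some pD)) + val (f (Some pE)) + val (f (Some pF)))).
move=> s3 s2; move: s3; rewrite s2 add0r -l1 => /addrI /val_inj /fI.
by [].
Qed.

(** * Free vector spaces and their cardinality *)

Section FreeSpace.
Variables (F : finFieldType) (K : Type).
(** The finitely supported functions from [K] to [F]; [{classic K}] gives [K] the choice structure
    that [malg] requires. *)
Local Notation V := (malg {classic K} F).

(** A vector is determined by the list of its support points with their coefficients; pairs and then
    lists are coded in [K]. *)
Lemma malg_inj : infinite_set [set: K] -> exists f : V -> K, injective f.
Proof.
move=> Kinf; have [q qI] := infinite_square_inj Kinf.
have [h hI _] := card_leT_inj (iffLR (infiniteP _) Kinf).
have [e eI] := infinite_seq_inj Kinf.
pose u (kc : {classic K} * F) : K := q kc.1 (h (enum_rank kc.2)).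
have uI : injective u.
  by move=> [k c] [k' c'] /qI[/= -> /hI/val_inj/enum_rank_inj ->].
exists (fun g => e [seq u (k, mcoeff k g) | k <- msupp g]).
move=> g g' /eI; rewrite (map_comp u) [RHS](map_comp u) => /(inj_map uI) E.
have gg' : msupp g = msupp g' :> seq _.
  by have := congr1 (map fst) E; rewrite -!map_comp !map_id.
move: E; rewrite -gg' => /eq_in_map E; apply/malgP => k.
have [/E[]//|kg] := boolP (k \in msupp g).
rewrite !mcoeff_outdom //.
by move: kg; rewrite -[k \in _]/(k \in (msupp g : seq _)) gg'.
Qed.

(** Basis vectors are nonzero and so lie in [P], which gives the lower bound; [malg_inj] gives the
    upper one. *)
Lemma card_malg (P : pred V) : infinite_set [set: K] ->
  (forall v : V, v != 0 -> P v) -> [set: zero_sum_structure P] #= [set: K].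
Proof.
move=> /malg_inj[f fI] P0; rewrite card_eq_le; apply/andP; split.
  apply: (@inj_card_leT _ _ (f \o val)); exact: inj_comp fI val_inj.
pose g (k : K) : V := mkmalgU (k : {classic K}) 1.
have gP k : P (g k) by rewrite P0 // monalgU_eq0 oner_neq0.
apply: (@inj_card_leT _ _ (fun k => exist (fun v => is_true (P v)) _ (gP k))).
move=> k k' /(congr1 val) /= /(congr1 (mcoeff (k : {classic K}))).
rewrite !mcoeffU eqxx.
by case: eqP => // _ /eqP; rewrite oner_eq0.
Qed.

End FreeSpace.

(** * Steiner systems in characteristics 2 and 3 *)

(** The third point is [u + v]: it is nonzero as [u <> v], and differs from each of [u] and [v] as
    the other is nonzero. *)
Lemma zero_sum_sts_char2 (V : zmodType) :
  (forall v : V, v + v = 0) ->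
  steiner_triple_system (zero_sum_structure (fun v : V => v != 0)).
Proof.
move=> char2; have oppE (v : V) : - v = v.
  by apply/eqP; rewrite -subr_eq0 -opprD char2 oppr0.
apply: zero_sum_sts => u v u0 v0 uv; rewrite oppE; split.
- by rewrite addr_eq0 oppE; apply/eqP.
- by move=> /(canRL (addKr _)); rewrite oppE char2; apply/eqP.
- by move=> /(canRL (addrK _)); rewrite subrr; apply/eqP.
Qed.

(** [- (u + v) = u] would give [2u + v = 0 = 3u], hence [v = u]; likewise for [v]. *)
Lemma zero_sum_sts_char3 (V : zmodType) :
  (forall v : V, v + v + v = 0) ->
  steiner_triple_system (zero_sum_structure (xpredT : pred V)).
Proof.
move=> char3; apply: zero_sum_sts => u v _ _ uv; split=> //.
- move=> /eqP; rewrite eqr_oppLR -subr_eq0 opprK addrAC => /eqP uuv.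
  by apply: uv; apply: (addrI (u + u)); rewrite char3.
- move=> /eqP; rewrite eqr_oppLR -subr_eq0 opprK => /eqP uvv.
  by apply: uv; apply: (addIr v); apply: (addIr v); rewrite char3.
Qed.

Theorem corollary2p1p5 (K : Type) (infK : infinite_set [set: K]) :
  (exists M : structure,
      [/\ steiner_triple_system M, anti mitre M, [set: M] #= [set: K]
        & strongly_minimal (theory M)]) /\
  (exists M : structure,
      [/\ steiner_triple_system M, anti mia M, [set: M] #= [set: K]
        & strongly_minimal (theory M)]).
Proof.
split.
  pose V : lmodType 'F_2 := malg {classic K} 'F_2.
  have char2 (v : V) : v + v = 0.
    rewrite -[v]scale1r -scalerDl (_ : 1 + 1 = 0) ?scale0r //; exact/eqP.
  have card : [set: zero_sum_structure (fun v : V => v != 0)] #= [set: K].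
    exact: card_malg.
  exists (zero_sum_structure (fun v : V => v != 0)); split=> //.
  - exact: zero_sum_sts_char2.
  - by apply: zero_sum_anti_mitre; rewrite ?eqxx.
  - apply: zero_sum_strongly_minimal => [u v ->//|].
    by rewrite (eq_finite_set card).
pose V : lmodType 'F_3 := malg {classic K} 'F_3.
have char3 (v : V) : v + v + v = 0.
  rewrite -[v]scale1r -!scalerDl (_ : 1 + 1 + 1 = 0) ?scale0r //; exact/eqP.
have card : [set: zero_sum_structure (xpredT : pred V)] #= [set: K].
  exact: card_malg.
exists (zero_sum_structure (xpredT : pred V)); split=> //.
- exact: zero_sum_sts_char3.
- exact: zero_sum_anti_mia.
- by apply: zero_sum_strongly_minimal; rewrite ?(eq_finite_set card).
Qed.
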